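(* Let $\mathrm{F}_2=\langle\alpha,\beta\rangle$ be the free group of rank $2$. The universal sub-line bundle $\mathcal{L}_{\mathrm{F}_2}$ on $\mathrm{Rep}_2(\mathrm{F}_2)_B$ is not trivial, i.e. it is not isomorphic to $\mathcal{O}_{\mathrm{Rep}_2(\mathrm{F}_2)_B}$.
   Context: Let $X$ be a scheme. A representation of degree $n$ for a group (resp. monoid) $\Gamma$ on $X$ is a group homomorphism $\rho:\Gamma\to \mathrm{GL}_n(\Gamma(X,\mathcal{O}_X))$ (resp. a monoid homomorphism $\rho:\Gamma\to \mathrm{M}_n(\Gamma(X,\mathcal{O}_X))$). A mold of degree $n$ on $X$ is a subsheaf of $\mathcal{O}_X$-algebras (containing the identity matrix) $\mathcal{A}\subseteq \mathrm{M}_n(\mathcal{O}_X)$ such that $\mathcal{A}$ and $\mathrm{M}_n(\mathcal{O}_X)/\mathcal{A}$ are locally free sheaves. Two molds $\mathcal{A},\mathcal{B}$ of degree $n$ on $X$ are locally equivalent if every $x\in X$ has an open neighborhood $U$ and some $P_U\in \mathrm{GL}_n(\mathcal{O}_U)$ with $P_U^{-1}(\mathcal{A}|_U)P_U=\mathcal{B}|_U$. Let $\mathcal{B}_n\subset \mathrm{M}_n(\mathbb{Z})$ be the subalgebra of upper triangular matrices. A Borel mold of degree $n$ on $X$ is a mold locally equivalent to $\mathcal{B}_n\otimes_{\mathbb{Z}}\mathcal{O}_X$. A representation with Borel mold on $X$ is a representation $\rho$ of degree $n$ on $X$ such that the subsheaf of $\mathcal{O}_X$-algebras $\mathcal{O}_X[\rho(\Gamma)]\subseteq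 \mathrm{M}_n(\mathcal{O}_X)$ generated by $\rho(\Gamma)$ is a Borel mold. $\mathrm{Rep}_n(\Gamma)_B$ is the scheme over $\mathbb{Z}$ representing the contravariant functor sending a scheme $X$ to the set of degree $n$ representations with Borel mold for $\Gamma$ on $X$; it is a subscheme of the affine scheme $\mathrm{Rep}_n(\Gamma)$ representing all degree $n$ representations of $\Gamma$. The universal representation makes $\Gamma$ act on the trivial bundle $\mathcal{O}^{\oplus n}_{\mathrm{Rep}_n(\Gamma)_B}$ (via $\mathrm{M}_n(\Gamma(X,\mathcal{O}_X))=\mathrm{End}_{\mathcal{O}_X}(\mathcal{O}_X^{\oplus n})$ with $X=\mathrm{Rep}_n(\Gamma)_B$). A subbundle of $\mathcal{O}_X^{\oplus n}$ is a locally free subsheaf with locally free quotient. For $n=2$ there is a unique $\Gamma$-invariant rank $1$ subbundle $\mathcal{L}_\Gamma\subset \mathcal{O}_{\mathrm{Rep}_2(\Gamma)_B}^{\oplus 2}$, called the universal sub-line bundle on $\mathrm{Rep}_2(\Gamma)_B$. *)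

(* Defs.v *)
From HB Require Import structures.
From mathcomp Require Import all_boot all_order all_algebra generic_quotient.
From mathcomp Require Import all_classical topology.
From mathcomp Require Import ring.

Set Implicit Arguments.
Unset Strict Implicit.
Unset Printing Implicit Defensive.

Import GRing.Theory.
Local Open Scope ring_scope.
Local Open Scope classical_set_scope.
Local Open Scope quotient_scope.

Record opens (X : topologicalType) := Opens {
  open_set :> set X;
  open_setP : open open_set
}.

Definition topO (X : topologicalType) : opens X := Opens openT.

Definition preO (X Y : topologicalType) (f : X -> Y) (fc : continuous f)
    (U : opens Y) : opens X :=
  Opens ((@continuousP X Y f).1 fc U (open_setP U)).

(* Rings of sections may be zero (they are on the empty set), whence
   comPzRingType and not comNzRingType. *)
Record ringedSpace := RingedSpace {
  rs_space :> topologicalType;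
  sec : opens rs_space -> comPzRingType;
  res : forall U V : opens rs_space, V `<=` U -> {rmorphism sec U -> sec V};
  res_id : forall (U : opens rs_space) (h : U `<=` U) (s : sec U), res h s = s;
  res_comp : forall (U V W : opens rs_space) (hVU : V `<=` U) (hWV : W `<=` V)
      (hWU : W `<=` U) (s : sec U), res hWV (res hVU s) = res hWU s;
  sheaf_sep : forall (U : opens rs_space) (s t : sec U),
    (forall x, open_set U x -> exists (V : opens rs_space) (h : V `<=` U),
        open_set V x /\ res h s = res h t) -> s = t;
  sheaf_glue : forall (U : opens rs_space) (I : Type)
      (V : I -> opens rs_space) (h : forall i, V i `<=` U)
      (s : forall i, sec (V i)),
    U `<=` \bigcup_i V i ->
    (forall i j (W : opens rs_space) (hi : W `<=` V i) (hj : W `<=` V j),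
        res hi (s i) = res hj (s j)) ->
    exists t : sec U, forall i, res (h i) t = s i
}.
Arguments res {r U V} _.

(* The germ at x of a section over a neighbourhood of x is a unit of the
   stalk at x. *)
Definition germ_unit (X : ringedSpace) (x : X) (U : opens X) (s : sec U) :=
  exists (V : opens X) (h : V `<=` U), open_set V x /\ exists t, res h s * t = 1.

(* The stalk at x is nonzero and its nonunits are closed under addition. *)
Definition local_stalk (X : ringedSpace) (x : X) :=
  (forall U : opens X, open_set U x -> ~ germ_unit x (0 : sec U)) /\
  (forall (U : opens X) (s t : sec U), open_set U x ->
     germ_unit x (s + t) -> germ_unit x s \/ germ_unit x t).

Record lrSpace := LRSpace {
  lr_space :> ringedSpace;
  lr_local : forall x : lr_space, local_stalk x
}.

Record lrMor (X Y : lrSpace) := LRMor {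
  mor_fun :> X -> Y;
  mor_cont : continuous mor_fun;
  mor_sec : forall U : opens Y, {rmorphism sec U -> sec (preO mor_cont U)};
  mor_res : forall (U V : opens Y) (h : V `<=` U)
      (h' : preO mor_cont V `<=` preO mor_cont U) (s : sec U),
    mor_sec V (res h s) = res h' (mor_sec U s);
  mor_local : forall (x : X) (U : opens Y) (s : sec U), open_set U (mor_fun x) ->
    germ_unit x (mor_sec U s) -> germ_unit (mor_fun x) s
}.

(* f induces an isomorphism of X onto an open subspace of Y. *)
Definition open_immersion (X Y : lrSpace) (f : lrMor X Y) :=
  [/\ injective f,
      forall V : set X, open V -> open (f @` V) &
      forall U : opens Y, U `<=` range f -> bijective (mor_sec f U)].

Record primeIdeal (A : comPzRingType) := PrimeIdeal {
  prime_set :> A -> Prop;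
  prime0 : prime_set 0;
  primeD : forall a b, prime_set a -> prime_set b -> prime_set (a + b);
  primeMl : forall a b, prime_set b -> prime_set (a * b);
  primeN1 : ~ prime_set 1;
  primeM : forall a b, prime_set (a * b) -> prime_set a \/ prime_set b
}.

HB.instance Definition _ (A : comPzRingType) := gen_eqMixin (primeIdeal A).
HB.instance Definition _ (A : comPzRingType) := gen_choiceMixin (primeIdeal A).

Section Zariski.
Variable A : comPzRingType.

Definition zariski_open (E : set (primeIdeal A)) :=
  exists I : set A, E = [set p | exists2 a, I a & ~ p a].

Lemma zariski_openT : zariski_open setT.
Proof.
exists setT; apply/seteqP; split => p // _.
by exists 1 => //; exact: primeN1.
Qed.

Lemma zariski_openI : setI_closed zariski_open.
Proof.
move=> _ _ [I ->] [J ->]; exists [set c | exists a b, [/\ I a, J b & c = a * b]].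
apply/seteqP; split => p /=.
  move=> [[a Ia pa] [b Jb pb]]; exists (a * b); first by exists a, b.
  by move/primeM => [].
move=> [_ [a [b [Ia Jb ->]]] pab]; split.
  by exists a => // pa; apply: pab; rewrite mulrC; exact: primeMl.
by exists b => // pb; apply: pab; exact: primeMl.
Qed.

Lemma zariski_open_bigU (I : Type) (f : I -> set (primeIdeal A)) :
  (forall i, zariski_open (f i)) -> zariski_open (\bigcup_i f i).
Proof.
move=> /choice [J fJ]; exists (\bigcup_i J i).
apply/seteqP; split => p /=.
  by move=> [i _]; rewrite fJ => -[a Ja pa]; exists a => //; exists i.
by move=> [a [i _ Ja] pa]; exists i => //; rewrite fJ; exists a.
Qed.

HB.instance Definition _ := isOpenTopological.Build (primeIdeal A)
  zariski_openT zariski_openI zariski_open_bigU.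

End Zariski.

Section Localization.
Variables (A : comPzRingType) (p : primeIdeal A).

Record ratio := Ratio { num : A; den : A; denP : ~ p den }.
HB.instance Definition _ := gen_eqMixin ratio.
HB.instance Definition _ := gen_choiceMixin ratio.

Definition ratio_equiv (x y : ratio) :=
  `[< exists2 u, ~ p u & u * (num x * den y - num y * den x) = 0 >].

Lemma primeNM (a b : A) : ~ p a -> ~ p b -> ~ p (a * b).
Proof. by move=> pa pb /primeM []. Qed.

Lemma ratio_equiv_refl : reflexive ratio_equiv.
Proof.
by move=> x; apply/asboolP; exists 1; [exact: primeN1|rewrite subrr mulr0].
Qed.

Lemma ratio_equiv_sym : symmetric ratio_equiv.
Proof.
suff H x y : ratio_equiv x y -> ratio_equiv y x.
  by move=> x y; apply/idP/idP; exact: H.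
move=> /asboolP[u pu e]; apply/asboolP; exists u => //.
by rewrite -opprB mulrN e oppr0.
Qed.

Lemma ratio_equiv_trans : transitive ratio_equiv.
Proof.
move=> y x z /asboolP[u pu eu] /asboolP[v pv ev]; apply/asboolP.
exists (u * v * den y); first by apply: primeNM; [exact: primeNM|exact: denP].
transitivity (v * den z * (u * (num x * den y - num y * den x)) +
              u * den x * (v * (num y * den z - num z * den y))).
  by ring.
by rewrite eu ev !mulr0 addr0.
Qed.

Canonical ratio_equiv_rel :=
  EquivRel ratio_equiv ratio_equiv_refl ratio_equiv_sym ratio_equiv_trans.

Definition localization := {eq_quot ratio_equiv}.
HB.instance Definition _ : EqQuotient _ ratio_equiv localization :=
  EqQuotient.on localization.
HB.instance Definition _ := Choice.on localization.

Definition mkloc (a b : A) (pb : ~ p b) : localization :=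
  \pi_localization (Ratio a pb).

Lemma mkloc_eq a b c d (pb : ~ p b) (pd : ~ p d) :
  mkloc a pb = mkloc c pd <-> exists2 u, ~ p u & u * (a * d - c * b) = 0.
Proof.
split=> [/eqP|h]; first by rewrite eqmodE => /asboolP.
by apply/eqP; rewrite eqmodE; apply/asboolP.
Qed.

Lemma mklocP (x : localization) : exists a b (pb : ~ p b), x = mkloc a pb.
Proof.
by elim/quotW: x => -[a b pb]; exists a, b, pb.
Qed.

Definition loc_lift1 (f : ratio -> ratio) (x : localization) : localization :=
  \pi_localization (f (repr x)).
Definition loc_lift2 (f : ratio -> ratio -> ratio) (x y : localization) :
  localization := \pi_localization (f (repr x) (repr y)).

Lemma mkloc_repr a b (pb : ~ p b) :
  exists2 u, ~ p u & u * (num (repr (mkloc a pb)) * b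
                          - a * den (repr (mkloc a pb))) = 0.
Proof.
have /eqP : \pi_localization (repr (mkloc a pb)) = mkloc a pb by rewrite reprK.
by rewrite eqmodE => /asboolP.
Qed.

Definition loc_opp :=
  loc_lift1 (fun x => Ratio (- num x) (@denP x)).
Definition loc_add := loc_lift2 (fun x y =>
  Ratio (num x * den y + num y * den x) (primeNM (@denP x) (@denP y))).
Definition loc_mul := loc_lift2 (fun x y =>
  Ratio (num x * num y) (primeNM (@denP x) (@denP y))).

Lemma loc_oppE a b (pb : ~ p b) : loc_opp (mkloc a pb) = mkloc (- a) pb.
Proof.
apply/mkloc_eq; have [u pu e] := mkloc_repr a pb; exists u => //=.
by rewrite -[RHS]oppr0 -[in RHS]e; ring.
Qed.

Lemma loc_addE a b (pb : ~ p b) c d (pd : ~ p d) :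
  loc_add (mkloc a pb) (mkloc c pd) = mkloc (a * d + c * b) (primeNM pb pd).
Proof.
apply/mkloc_eq.
have [u pu eu] := mkloc_repr a pb; have [v pv ev] := mkloc_repr c pd.
set r := repr _ in eu *; set s := repr _ in ev *.
exists (u * v) => /=; first exact: primeNM.
transitivity (v * d * den s * (u * (num r * b - a * den r)) +
              u * b * den r * (v * (num s * d - c * den s))); first by ring.
by rewrite eu ev !mulr0 addr0.
Qed.

Lemma loc_mulE a b (pb : ~ p b) c d (pd : ~ p d) :
  loc_mul (mkloc a pb) (mkloc c pd) = mkloc (a * c) (primeNM pb pd).
Proof.
apply/mkloc_eq.
have [u pu eu] := mkloc_repr a pb; have [v pv ev] := mkloc_repr c pd.
set r := repr _ in eu *; set s := repr _ in ev *.
exists (u * v) => /=; first exact: primeNM.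
transitivity (v * d * num s * (u * (num r * b - a * den r)) +
              u * a * den r * (v * (num s * d - c * den s))); first by ring.
by rewrite eu ev !mulr0 addr0.
Qed.

Lemma mkloc_congr a b (pb : ~ p b) c d (pd : ~ p d) :
  a * d = c * b -> mkloc a pb = mkloc c pd.
Proof.
by move=> e; apply/mkloc_eq; exists 1; [exact: primeN1|rewrite e subrr mulr0].
Qed.

Definition loc0 := mkloc 0 (@primeN1 _ p).
Definition loc1 := mkloc 1 (@primeN1 _ p).

Lemma loc_addA : associative loc_add.
Proof.
move=> x y z; have [a [b [pb ->]]] := mklocP x.
have [c [d [pd ->]]] := mklocP y; have [e [f [pf ->]]] := mklocP z.
by rewrite !loc_addE; apply: mkloc_congr; ring.
Qed.

Lemma loc_addC : commutative loc_add.
Proof.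
move=> x y; have [a [b [pb ->]]] := mklocP x; have [c [d [pd ->]]] := mklocP y.
by rewrite !loc_addE; apply: mkloc_congr; ring.
Qed.

Lemma loc_add0 : left_id loc0 loc_add.
Proof.
move=> x; have [a [b [pb ->]]] := mklocP x.
by rewrite loc_addE; apply: mkloc_congr; ring.
Qed.

Lemma loc_addN : left_inverse loc0 loc_opp loc_add.
Proof.
move=> x; have [a [b [pb ->]]] := mklocP x.
by rewrite loc_oppE loc_addE; apply: mkloc_congr; ring.
Qed.

HB.instance Definition _ :=
  GRing.isZmodule.Build localization loc_addA loc_addC loc_add0 loc_addN.

Lemma loc_mulA : associative loc_mul.
Proof.
move=> x y z; have [a [b [pb ->]]] := mklocP x.
have [c [d [pd ->]]] := mklocP y; have [e [f [pf ->]]] := mklocP z.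
by rewrite !loc_mulE; apply: mkloc_congr; ring.
Qed.

Lemma loc_mulC : commutative loc_mul.
Proof.
move=> x y; have [a [b [pb ->]]] := mklocP x; have [c [d [pd ->]]] := mklocP y.
by rewrite !loc_mulE; apply: mkloc_congr; ring.
Qed.

Lemma loc_mul1 : left_id loc1 loc_mul.
Proof.
move=> x; have [a [b [pb ->]]] := mklocP x.
by rewrite loc_mulE; apply: mkloc_congr; ring.
Qed.

Lemma loc_mulDl : left_distributive loc_mul loc_add.
Proof.
move=> x y z; have [a [b [pb ->]]] := mklocP x.
have [c [d [pd ->]]] := mklocP y; have [e [f [pf ->]]] := mklocP z.
by rewrite (loc_addE _ pb _ pd) !loc_mulE loc_addE; apply: mkloc_congr; ring.
Qed.

HB.instance Definition _ := GRing.Zmodule_isComPzRing.Build localization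
  loc_mulA loc_mulC loc_mul1 loc_mulDl.

End Localization.

Section SpecSheaf.
Variable A : comPzRingType.
Implicit Types U V W : opens (primeIdeal A).

Definition locally_fraction U
    (s : forall p : primeIdeal A, open_set U p -> localization p) :=
  forall p, open_set U p -> exists V : opens (primeIdeal A),
    [/\ open_set V p, V `<=` U &
        exists a b : A, forall q (Uq : open_set U q), open_set V q ->
          exists qb : ~ q b, s q Uq = mkloc a qb].

Record spec_sec U := SpecSec {
  sec_val : forall p : primeIdeal A, open_set U p -> localization p;
  sec_valP : locally_fraction sec_val
}.
HB.instance Definition _ U := gen_eqMixin (spec_sec U).
HB.instance Definition _ U := gen_choiceMixin (spec_sec U).

Lemma spec_sec_ext U (s t : spec_sec U) :
  (forall p (Up : open_set U p), sec_val s Up = sec_val t Up) -> s = t.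
Proof.
case: s t => [s sP] [t tP] /= st.
have e : s = t.
  by apply: functional_extensionality_dep => p;
     apply: functional_extensionality_dep => Up; exact: st.
by subst t; congr SpecSec; exact: Prop_irrelevance.
Qed.

Definition opensI U V : opens (primeIdeal A) :=
  Opens (openI (open_setP U) (open_setP V)).

Lemma locally_fraction_cst U (a b : A) (h : forall p, open_set U p -> ~ p b) :
  locally_fraction (fun p Up => mkloc a (h p Up)).
Proof.
move=> p Up; exists U; split => //; exists a, b => q Uq _.
by exists (h q Uq).
Qed.

Lemma locally_fraction_opp U (s : spec_sec U) :
  locally_fraction (fun p Up => - sec_val s (p := p) Up).
Proof.
move=> p /(sec_valP s)[V [Vp VU [a [b h]]]].
exists V; split => //; exists (- a), b => q Uq /(h q Uq)[qb ->].
by exists qb; exact: loc_oppE.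
Qed.

Lemma locally_fraction_add U (s t : spec_sec U) :
  locally_fraction (fun p Up => sec_val s (p := p) Up + sec_val t Up).
Proof.
move=> p Up; have [V [Vp VU [a [b h]]]] := sec_valP s Up.
have [W [Wp WU [c [d k]]]] := sec_valP t Up.
exists (opensI V W); split => //; first by move=> q [/VU].
exists (a * d + c * b), (b * d) => q Uq [/(h q Uq)[qb ->] /(k q Uq)[qd ->]].
by exists (primeNM qb qd); exact: loc_addE.
Qed.

Lemma locally_fraction_mul U (s t : spec_sec U) :
  locally_fraction (fun p Up => sec_val s (p := p) Up * sec_val t Up).
Proof.
move=> p Up; have [V [Vp VU [a [b h]]]] := sec_valP s Up.
have [W [Wp WU [c [d k]]]] := sec_valP t Up.
exists (opensI V W); split => //; first by move=> q [/VU].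
exists (a * c), (b * d) => q Uq [/(h q Uq)[qb ->] /(k q Uq)[qd ->]].
by exists (primeNM qb qd); exact: loc_mulE.
Qed.

Definition spec_cst U (a : A) : spec_sec U :=
  SpecSec (locally_fraction_cst a (fun p (_ : open_set U p) => @primeN1 A p)).
Definition spec_opp U (s : spec_sec U) := SpecSec (locally_fraction_opp s).
Definition spec_add U (s t : spec_sec U) := SpecSec (locally_fraction_add s t).
Definition spec_mul U (s t : spec_sec U) := SpecSec (locally_fraction_mul s t).

Lemma spec_addA U : associative (@spec_add U).
Proof. by move=> s t u; apply: spec_sec_ext => p Up /=; exact: addrA. Qed.
Lemma spec_addC U : commutative (@spec_add U).
Proof. by move=> s t; apply: spec_sec_ext => p Up /=; exact: addrC. Qed.
Lemma spec_add0 U : left_id (spec_cst U 0) (@spec_add U).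
Proof. by move=> s; apply: spec_sec_ext => p Up /=; exact: add0r. Qed.
Lemma spec_addN U : left_inverse (spec_cst U 0) (@spec_opp U) (@spec_add U).
Proof. by move=> s; apply: spec_sec_ext => p Up /=; exact: addNr. Qed.
HB.instance Definition _ U := GRing.isZmodule.Build (spec_sec U)
  (@spec_addA U) (@spec_addC U) (@spec_add0 U) (@spec_addN U).

Lemma spec_mulA U : associative (@spec_mul U).
Proof. by move=> s t u; apply: spec_sec_ext => p Up /=; exact: mulrA. Qed.
Lemma spec_mulC U : commutative (@spec_mul U).
Proof. by move=> s t; apply: spec_sec_ext => p Up /=; exact: mulrC. Qed.
Lemma spec_mul1 U : left_id (spec_cst U 1) (@spec_mul U).
Proof. by move=> s; apply: spec_sec_ext => p Up /=; exact: mul1r. Qed.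
Lemma spec_mulDl U : left_distributive (@spec_mul U) (@spec_add U).
Proof. by move=> s t u; apply: spec_sec_ext => p Up /=; exact: mulrDl. Qed.
HB.instance Definition _ U := GRing.Zmodule_isComPzRing.Build (spec_sec U)
  (@spec_mulA U) (@spec_mulC U) (@spec_mul1 U) (@spec_mulDl U).

Lemma locally_fraction_res U V (h : V `<=` U) (s : spec_sec U) :
  locally_fraction (fun p Vp => sec_val s (h p Vp)).
Proof.
move=> p Vp; have [W [Wp WU [a [b k]]]] := sec_valP s (h p Vp).
exists (opensI V W); split => //; first by move=> q [].
by exists a, b => q Vq [_ Wq]; exact: k.
Qed.

Definition spec_res U V (h : V `<=` U) (s : spec_sec U) : spec_sec V :=
  SpecSec (locally_fraction_res h s).

Lemma spec_res_zmod U V (h : V `<=` U) : zmod_morphism (spec_res h).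
Proof. by move=> s t; apply: spec_sec_ext. Qed.
Lemma spec_res_monoid U V (h : V `<=` U) : monoid_morphism (spec_res h).
Proof. by split=> [|s t]; apply: spec_sec_ext. Qed.
HB.instance Definition _ U V (h : V `<=` U) :=
  GRing.isZmodMorphism.Build _ _ (spec_res h) (spec_res_zmod h).
HB.instance Definition _ U V (h : V `<=` U) :=
  GRing.isMonoidMorphism.Build _ _ (spec_res h) (spec_res_monoid h).

Lemma sec_val_irr U (s : spec_sec U) p (h k : open_set U p) :
  sec_val s h = sec_val s k.
Proof. by congr sec_val; exact: Prop_irrelevance. Qed.

Lemma spec_res_id U (h : U `<=` U) (s : spec_sec U) : spec_res h s = s.
Proof. by apply: spec_sec_ext => p Up /=; apply: sec_val_irr. Qed.

Lemma spec_res_comp U V W (hVU : V `<=` U) (hWV : W `<=` V) (hWU : W `<=` U)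
  (s : spec_sec U) : spec_res hWV (spec_res hVU s) = spec_res hWU s.
Proof. by apply: spec_sec_ext => p Up /=; apply: sec_val_irr. Qed.

Lemma spec_sep U (s t : spec_sec U) :
  (forall p, open_set U p -> exists V (h : V `<=` U),
      open_set V p /\ spec_res h s = spec_res h t) -> s = t.
Proof.
move=> st; apply: spec_sec_ext => p Up; have [V [h [Vp e]]] := st p Up.
have := congr1 (fun r => sec_val r Vp) e.
by rewrite /= (sec_val_irr s _ Up) (sec_val_irr t _ Up).
Qed.

Lemma spec_glue U (I : Type) (V : I -> opens (primeIdeal A))
    (h : forall i, V i `<=` U) (s : forall i, spec_sec (V i)) :
  U `<=` \bigcup_i V i ->
  (forall i j W (hi : W `<=` V i) (hj : W `<=` V j),
      spec_res hi (s i) = spec_res hj (s j)) ->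
  exists t : spec_sec U, forall i, spec_res (h i) t = s i.
Proof.
move=> UV ss.
have ix p (Up : open_set U p) : {i : I | open_set (V i) p}.
  by apply: cid; have [i _ Vip] := UV p Up; exists i.
pose t p Up := sec_val (s (sval (ix p Up))) (svalP (ix p Up)).
have tE p (Up : open_set U p) i (Vip : open_set (V i) p) :
    t p Up = sec_val (s i) Vip.
  rewrite /t; case: (ix p Up) => j /= Vjp.
  have hi : opensI (V i) (V j) `<=` V i by move=> q [].
  have hj : opensI (V i) (V j) `<=` V j by move=> q [].
  have Wp : open_set (opensI (V i) (V j)) p by split.
  have := congr1 (fun r => sec_val r Wp) (ss _ _ _ hi hj).
  rewrite /= (sec_val_irr (s i) _ Vip) (sec_val_irr (s j) _ Vjp).
  by move=> ->; apply: sec_val_irr.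
have tP : locally_fraction t.
  move=> p Up; have [i _ Vip] := UV p Up.
  have [W [Wp WV [a [b k]]]] := sec_valP (s i) Vip.
  exists W; split => //; first by move=> q /WV; exact: h.
  by exists a, b => q Uq Wq; rewrite (tE q Uq i (WV q Wq)); exact: k.
by exists (SpecSec tP) => i; apply: spec_sec_ext => p Vip; exact: tE.
Qed.

Definition specRS : ringedSpace :=
  @RingedSpace (primeIdeal A) (fun U => spec_sec U : comPzRingType)
    (fun U V h => spec_res h : {rmorphism spec_sec U -> spec_sec V})
    spec_res_id spec_res_comp spec_sep spec_glue.

Lemma mkloc_unit (p : primeIdeal A) a b (pb : ~ p b) (y : localization p) :
  mkloc a pb * y = 1 -> ~ p a.
Proof.
have [c [d [pd ->]]] := mklocP y.
rewrite [LHS](loc_mulE a pb c pd) => /mkloc_eq[u pu].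
rewrite mulr1 mul1r mulrBr => /eqP; rewrite subr_eq0 => /eqP e pa.
have : p (u * (b * d)) by rewrite -e mulrCA mulrC; exact: primeMl.
by apply: primeNM => //; exact: primeNM.
Qed.

Lemma spec_germ_unit (p : specRS) (U : opens specRS) (s : sec U)
    (Up : open_set U p) :
  germ_unit p s <-> exists y, sec_val (s : spec_sec U) Up * y = 1.
Proof.
split=> [[V [h [Vp [t e]]]]|[y e]].
  exists (sec_val (t : spec_sec V) Vp); rewrite (sec_val_irr _ _ (h p Vp)).
  exact: (congr1 (fun r => sec_val (r : spec_sec V) Vp) e).
have [V [Vp VU [a [b k]]]] := sec_valP (s : spec_sec U) Up.
have pa : ~ p a.
  by have [pb sE] := k p Up Vp; move: e; rewrite sE; exact: mkloc_unit.
have oD : open [set q : primeIdeal A | ~ q a].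
  exists [set a]; apply/seteqP; split => q /=; first by exists a.
  by move=> [_ ->].
pose W := opensI V (Opens oD).
have WU : W `<=` U by move=> q [/VU].
exists W, WU; split=> //.
have Wa q : open_set W q -> ~ q a by case.
exists (SpecSec (locally_fraction_cst b Wa) : spec_sec W).
apply: spec_sec_ext => q Wq /=.
have [qb ->] := k q (WU q Wq) (Wq.1).
by rewrite [LHS]loc_mulE; apply: mkloc_congr; ring.
Qed.

Lemma spec_local (p : specRS) : local_stalk p.
Proof.
split=> [U Up|U s t Up].
  move=> /(@spec_germ_unit _ _ _ Up)[y].
  move/mkloc_unit; apply; exact: prime0.
have sE := @spec_germ_unit p U _ Up.
move=> /sE[y]; move: (sE s) (sE t).
set x := sec_val _ _; set z := sec_val _ _ => hs ht.
have -> : sec_val (s + t : spec_sec U) Up = x + z by [].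
move: hs ht; have [a [b [pb ->]]] := mklocP x.
have [c [d [pd ->]]] := mklocP z => hs ht.
have inv u v (pv : ~ p v) : ~ p u -> exists w, mkloc u pv * w = 1.
  by move=> pu; exists (mkloc v pu); rewrite [LHS]loc_mulE;
     apply: mkloc_congr; ring.
rewrite [X in X * _](loc_addE a pb c pd) => /mkloc_unit pac.
case: (pselect (p a)) => pa; last by left; apply/hs; exact: inv.
right; apply/ht; apply: inv => pc; apply: pac.
by apply: primeD; rewrite mulrC; exact: primeMl.
Qed.

Definition Spec : lrSpace := LRSpace spec_local.

End SpecSheaf.

Record scheme := Scheme {
  scheme_space :> lrSpace;
  scheme_affine : forall x : scheme_space,
    exists (A : comPzRingType) (i : lrMor (Spec A) scheme_space),
      open_immersion i /\ range i x
}.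

(* The canonical map from sections of O_Y over U to sections of O_X over V,
   for V contained in the preimage of U. *)
Definition pull (X Y : lrSpace) (f : lrMor X Y) (U : opens Y) (V : opens X)
    (h : V `<=` preO (@mor_cont _ _ f) U) (s : sec U) : sec V :=
  res h (mor_sec f U s).

Definition mor_eq (X Y : lrSpace) (f g : lrMor X Y) :=
  (forall x, f x = g x) /\
  (forall (U : opens Y) (V : opens X) (hf : V `<=` preO (@mor_cont _ _ f) U)
     (hg : V `<=` preO (@mor_cont _ _ g) U) (s : sec U),
     pull hf s = pull hg s).

(* A subsheaf of O_X-modules of the free sheaf of m x n matrices over O_X;
   the free sheaf O_X^n is the case of column vectors. *)
Record subsheaf (X : ringedSpace) (m n : nat) := Subsheaf {
  sub_sec :> forall U : opens X, set 'M[sec U]_(m, n);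
  sub0 : forall U : opens X, @sub_sec U 0;
  sub_linear : forall (U : opens X) (a : sec U) (s t : 'M[sec U]_(m, n)),
    @sub_sec U s -> @sub_sec U t -> @sub_sec U (a *: s + t);
  sub_res : forall (U V : opens X) (h : V `<=` U) (s : 'M[sec U]_(m, n)),
    @sub_sec U s -> @sub_sec V (map_mx (res h) s);
  sub_glue : forall (U : opens X) (s : 'M[sec U]_(m, n)),
    (forall x, open_set U x -> exists (V : opens X) (h : V `<=` U),
        open_set V x /\ @sub_sec V (map_mx (res h) s)) -> @sub_sec U s
}.
Arguments sub_sec {X m n} _ U _.

Definition free_sheaf (X : ringedSpace) (n : nat) : subsheaf X n 1.
Proof. by exists (fun U => setT). Defined.

(* The restrictions of F and G to U are isomorphic sheaves of modules; only
   the values of f at sections of F matter. *)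
Definition iso_on (X : ringedSpace) (U : opens X) (m n p q : nat)
    (F : subsheaf X m n) (G : subsheaf X p q) :=
  exists f : forall V : opens X, V `<=` U -> 'M[sec V]_(m, n) -> 'M[sec V]_(p, q),
    [/\ forall (V : opens X) (h : V `<=` U), set_bij (F V) (G V) (f V h),
        forall (V : opens X) (h : V `<=` U) (a : sec V) s t, F V s -> F V t ->
          f V h (a *: s + t) = a *: f V h s + f V h t &
        forall (V W : opens X) (hV : V `<=` U) (hW : W `<=` U) (h : W `<=` V) s,
          F V s -> f W hW (map_mx (res h) s) = map_mx (res h) (f V hV s)].

Definition sheaf_iso (X : ringedSpace) (m n p q : nat)
  (F : subsheaf X m n) (G : subsheaf X p q) := iso_on (topO X) F G.

Definition locally_free (X : ringedSpace) (m n : nat) (F : subsheaf X m n) :=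
  forall x : X, exists (U : opens X) (r : nat),
    open_set U x /\ iso_on U F (free_sheaf X r).

Definition locally_free_of_rank (r : nat) (X : ringedSpace) (m n : nat)
    (F : subsheaf X m n) :=
  forall x : X, exists U : opens X,
    open_set U x /\ iso_on U F (free_sheaf X r).

(* The quotient sheaf of all m x n matrices by F is isomorphic to O^r over U,
   stated on the ambient free sheaf: there is an epimorphism of sheaves (hence
   surjective locally) onto O^r over U with kernel F. *)
Definition quotient_free_on (X : ringedSpace) (U : opens X) (m n r : nat)
    (F : subsheaf X m n) :=
  exists f : forall V : opens X, V `<=` U -> 'M[sec V]_(m, n) -> 'cV[sec V]_r,
    [/\ forall (V : opens X) (h : V `<=` U) (a : sec V) s t,
          f V h (a *: s + t) = a *: f V h s + f V h t,
        forall (V W : opens X) (hV : V `<=` U) (hW : W `<=` U) (h : W `<=` V) s,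
          f W hW (map_mx (res h) s) = map_mx (res h) (f V hV s),
        forall (V : opens X) (h : V `<=` U) s, f V h s = 0 <-> F V s &
        forall (V : opens X) (h : V `<=` U) (t : 'cV[sec V]_r) x, open_set V x ->
          exists (W : opens X) (hW : W `<=` U) (hWV : W `<=` V) s,
            open_set W x /\ f W hW s = map_mx (res hWV) t].

Definition locally_free_quotient (X : ringedSpace) (m n : nat)
    (F : subsheaf X m n) :=
  forall x : X, exists (U : opens X) (r : nat),
    open_set U x /\ quotient_free_on U r F.

Definition subalgebra_sheaf (X : ringedSpace) (n : nat) (F : subsheaf X n n) :=
  forall U : opens X, F U 1%:M /\
    forall s t : 'M[sec U]_n, F U s -> F U t -> F U (s *m t).

Definition mold (X : ringedSpace) (n : nat) (F : subsheaf X n n) :=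
  [/\ subalgebra_sheaf F, locally_free F & locally_free_quotient F].

(* Q is the inverse of P. *)
Definition locally_equivalent (X : ringedSpace) (n : nat)
    (F G : subsheaf X n n) :=
  forall x : X, exists (U : opens X) (P Q : 'M[sec U]_n),
    [/\ open_set U x, P *m Q = 1%:M, Q *m P = 1%:M &
        forall (V : opens X) (h : V `<=` U), G V =
          [set map_mx (res h) Q *m s *m map_mx (res h) P | s in F V]].

(* Since the integral upper triangular matrices B_n are a direct factor of
   M_n(Z), the sheaf B_n (x) O_X consists of the upper triangular matrices with
   entries in O_X. *)
Definition triangular_sheaf (X : ringedSpace) (n : nat) : subsheaf X n n.
Proof.
exists (fun U => [set s | forall i j : 'I_n, (j < i)%N -> s i j = 0]).
- by move=> U i j _; rewrite mxE.
- by move=> U a s t s0 t0 i j ij; rewrite !mxE s0 // t0 // mulr0 addr0.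
- by move=> U V h s s0 i j ij; rewrite mxE s0 // rmorph0.
- move=> U s s0 i j ij; apply: sheaf_sep => x /s0 [V [h [Vx sV]]].
  exists V, h; split=> //.
  by have := sV i j ij; rewrite mxE rmorph0.
Defined.

Definition borel_mold (X : ringedSpace) (n : nat) (F : subsheaf X n n) :=
  mold F /\ locally_equivalent F (triangular_sheaf X n).

(* The smallest subsheaf of algebras having the elements of S among its global
   sections. *)
Definition generated_algebra (X : ringedSpace) (n : nat)
  (S : set 'M[@sec X (topO X)]_n) : subsheaf X n n.
Proof.
exists (fun U => [set s | forall F : subsheaf X n n,
  subalgebra_sheaf F -> S `<=` F (topO X) -> F U s]).
- by move=> U F _ _; exact: sub0.
- by move=> U a s t Hs Ht F FA SF; apply: sub_linear; [exact: Hs|exact: Ht].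
- by move=> U V h s Hs F FA SF; apply: sub_res; exact: Hs.
- move=> U s Hs F FA SF; apply: sub_glue => x /Hs [V [h [Vx HV]]].
  by exists V, h; split=> //; exact: HV.
Defined.

Record representation (G : groupType) (n : nat) (X : ringedSpace) :=
  Representation {
  rep_fun :> G -> 'M[@sec X (topO X)]_n;
  rep_1 : rep_fun 1%g = 1%:M;
  rep_M : forall g h, rep_fun (g * h)%g = rep_fun g *m rep_fun h;
  rep_GL : forall g, exists2 Q, rep_fun g *m Q = 1%:M & Q *m rep_fun g = 1%:M
}.

Definition with_borel_mold (G : groupType) (n : nat) (X : ringedSpace)
    (rho : representation G n X) :=
  borel_mold (generated_algebra (range rho)).

Definition pull_global (X Y : lrSpace) (f : lrMor X Y) :
    @sec Y (topO Y) -> @sec X (topO X) :=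
  @pull X Y f (topO Y) (topO X) (fun x _ => Logic.I).

Definition is_pullback (G : groupType) (n : nat) (X Y : lrSpace)
    (f : lrMor X Y) (rho : representation G n Y) (sigma : representation G n X) :=
  forall g, map_mx (pull_global f) (rho g) = sigma g.

(* X represents the functor of degree n representations of G with Borel mold
   and rho is the universal one. *)
Definition represents_borel_reps (G : groupType) (n : nat) (X : scheme)
    (rho : representation G n X) :=
  with_borel_mold rho /\
  forall (Y : scheme) (sigma : representation G n Y), with_borel_mold sigma ->
    exists f : lrMor Y X, is_pullback f rho sigma /\
      forall f' : lrMor Y X, is_pullback f' rho sigma -> mor_eq f' f.

Definition invariant_subsheaf (G : groupType) (n : nat) (X : ringedSpace)
    (rho : representation G n X) (L : subsheaf X n 1) :=
  forall g (U : opens X) (v : 'cV[sec U]_n), L U v ->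
    L U (map_mx (@res X (topO X) U (@subsetT _ U)) (rho g) *m v).

(* For n = 2 and rho the universal representation with Borel mold, there is
   exactly one such L. *)
Definition universal_sub_line_bundle (G : groupType) (X : ringedSpace)
    (rho : representation G 2 X) (L : subsheaf X 2 1) :=
  [/\ invariant_subsheaf rho L, locally_free_of_rank 1 L &
      locally_free_quotient L].

Definition free_group2 (F : groupType) (a b : F) :=
  forall (G : groupType) (x y : G), exists! f : F -> G,
    [/\ {morph f : u v / (u * v)%g}, f a = x & f b = y].

(* Main.v *)
(* Over the nodal cubic A = {p in Q[t] | p(0) = p(1)}, the module
   M = {p in Q[t] | p(1) = - p(0)} is invertible, of order 2 and not free: a
   generator would be a unit of Q[t], hence constant, hence 0.  From c, s, c', s'
   in M with c c' + s s' = 1 one gets an idempotent E = (c,s)^T (c',s') of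
   M_2(A) with image isomorphic to M and a matrix N = (c,s)^T (-s,c) with E N = N, N E = 0.
   The matrices 1 - 2 E and 1 + N define a representation of F_2 over A;
   conjugating locally by a basis adapted to E makes E and N into e_11 and
   a unit multiple of e_12, so that it has Borel mold.  If the universal line
   bundle were trivial, pulling back a generator along the classifying
   morphism Spec A -> X would give a unimodular vector of A^2 spanning a line
   stable under 1 + N, that is, a generator of M. *)
Require Import Defs.
From mathcomp Require Import all_boot all_algebra.
From HB Require Import structures.
From mathcomp Require Import all_classical topology.
From mathcomp Require Import ring.

Set Implicit Arguments.
Unset Strict Implicit.
Unset Printing Implicit Defensive.

Import GRing.Theory.
Local Open Scope ring_scope.
Local Open Scope classical_set_scope.

(** * Existence of prime ideals *)

Section PrimeExistence.
Variable A : comPzRingType.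

Definition is_ideal (I : set A) :=
  [/\ I 0, forall a b, I a -> I b -> I (a + b) & forall a b, I b -> I (a * b)].

(** Among the ideals containing [I] but not 1, a maximal one given by Zorn's lemma would be prime.
    The lemma serves to globalize: the elements that achieve some goal form an ideal, and near each
    prime one of them is found outside it. *)
Lemma prime_avoiding_unit (I : set A) : is_ideal I ->
  (forall p : primeIdeal A, exists2 a, I a & ~ p a) -> I 1.
Proof.
move=> [I0 ID IM] Ip; apply: contrapT => I1.
(* The empty set is allowed so that the empty chain has an upper bound. *)
pose P (J : set A) := [/\ forall a, J a -> I `<=` J,
  forall a b, J a -> J b -> J (a + b), forall a b, J b -> J (a * b) & ~ J 1].
have [|M [[MI MD MM M1] Mmax]] := @Zorn_bigcup A P.
  move=> F FP Ftot; split.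
  - move=> a [J FJ Ja] b Ib; exists J => //; have [h _ _ _] := FP J FJ.
    exact: h Ja _ Ib.
  - move=> a b [J FJ Ja] [K FK Kb].
    have [JK|KJ] := Ftot _ _ FJ FK.
      by exists K => //; have [_ h _ _] := FP K FK; apply: h => //; exact: JK.
    by exists J => //; have [_ h _ _] := FP J FJ; apply: h => //; exact: KJ.
  - by move=> a b [J FJ Jb]; exists J => //; have [_ _ h _] := FP J FJ; exact: h.
  - by move=> [J FJ J1]; have [_ _ _] := FP J FJ.
(* If [M] missed 0 it would be empty, and [I] would be a larger member of [P]. *)
have M0 : M 0.
  apply: contrapT => nM0; apply: (Mmax I); last by split => // a _.
  split; last by move=> /(_ 0 I0).
  by move=> a Ma; case: nM0; rewrite -(mul0r a); exact: MM.
have Mprime a b : M (a * b) -> M a \/ M b.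
  move=> Mab; case: (pselect (M a)) => Ma; [by left|right].
  pose J := [set z | exists2 m, M m & exists x, z = m + a * x].
  have MJ : M `<=` J by move=> m Mm; exists m => //; exists 0; ring.
  have : J 1.
    apply: contrapT => J1; apply: (Mmax J).
      split=> // JM; apply: Ma; apply: JM; exists 0 => //.
      by exists 1; ring.
    split=> //.
    - by move=> _ _; exact: subset_trans (MI 0 M0) MJ.
    - move=> _ _ [m Mm [x ->]] [n Mn [y ->]]; exists (m + n); first exact: MD.
      by exists (x + y); ring.
    - move=> z _ [m Mm [x ->]]; exists (z * m); first exact: MM.
      by exists (z * x); ring.
  move=> [m Mm [x e]]; have -> : b = b * m + x * (a * b).
    by transitivity (b * 1); [ring|rewrite e; ring].
  by apply: MD; exact: MM.
have [a Ia] := Ip (PrimeIdeal M0 MD MM M1 Mprime).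
by apply; exact: (MI 0 M0).
Qed.

End PrimeExistence.

(** * Sections of the structure sheaf of an affine scheme *)

Section SpecConstants.
Variable A : comPzRingType.
Implicit Types U V : opens (primeIdeal A).

Lemma spec_cst_zmod U : zmod_morphism (@spec_cst A U).
Proof.
move=> a b; apply: spec_sec_ext => p Up /=.
rewrite [in RHS](loc_oppE b (@primeN1 A p) : - mkloc b _ = _).
by rewrite [RHS]loc_addE; apply: mkloc_congr; ring.
Qed.

Lemma spec_cst_monoid U : monoid_morphism (@spec_cst A U).
Proof.
split=> [|a b]; apply: spec_sec_ext => p Up //=.
by rewrite [RHS]loc_mulE; apply: mkloc_congr; ring.
Qed.

HB.instance Definition _ U :=
  GRing.isZmodMorphism.Build A (spec_sec U) (@spec_cst A U) (@spec_cst_zmod U).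
HB.instance Definition _ U :=
  GRing.isMonoidMorphism.Build A (spec_sec U) (@spec_cst A U)
    (@spec_cst_monoid U).

Lemma spec_res_cst U V (h : V `<=` U) (a : A) :
  spec_res h (spec_cst U a) = spec_cst V a.
Proof. by apply: spec_sec_ext. Qed.

Definition basic_open (a : A) : opens (primeIdeal A).
Proof.
exists [set p : primeIdeal A | ~ p a]; exists [set a]; apply/seteqP; split => p /=.
  by exists a.
by move=> [_ ->].
Defined.

Lemma spec_cst_unit (a : A) (U : opens (primeIdeal A)) :
  U `<=` basic_open a -> exists s : spec_sec U, spec_cst U a * s = 1.
Proof.
move=> Ua; exists (SpecSec (@locally_fraction_cst A U 1 a Ua)).
by apply: spec_sec_ext => p Up /=; rewrite [LHS]loc_mulE; apply: mkloc_congr; ring.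
Qed.

Hypothesis dom : forall a b : A, a * b = 0 -> a = 0 \/ b = 0.
Hypothesis nz1 : (1 : A) <> 0.

Definition zero_prime : primeIdeal A.
Proof.
exists (fun a => a = 0) => //.
- by move=> a b -> ->; rewrite addr0.
- by move=> a b ->; rewrite mulr0.
Defined.

(** The generic point lies in every nonempty open set, so two local expressions of one section can
    be compared in the fraction field. *)
Lemma zero_prime_open U p : open_set U p -> open_set U zero_prime.
Proof.
have [I ->] := open_setP U => -[a Ia pa]; exists a => // a0; apply: pa.
by rewrite a0; exact: prime0.
Qed.

Lemma mkloc_zero_prime a b c d (pb : ~ zero_prime b) (pd : ~ zero_prime d) :
  mkloc a pb = mkloc c pd -> a * d = c * b.
Proof. by move=> /mkloc_eq[u u0] /dom[//|/eqP]; rewrite subr_eq0 => /eqP. Qed.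

Lemma spec_cst_inj : injective (@spec_cst A (topO _)).
Proof.
move=> a b /(congr1 (fun s => sec_val s (I : open_set (topO _) zero_prime))).
by move=> /mkloc_zero_prime; rewrite !mulr1.
Qed.

(** The denominators of [s], those [d] with [s * d] in [A], form an ideal. If [s = a / b] near a
    prime, then [b] is a denominator on the whole spectrum: any other local fraction [c / d] of [s]
    agrees with [a / b] at the generic point, whence [a * d = c * b] in the domain [A]. *)
Lemma spec_global (s : spec_sec (topO (primeIdeal A))) :
  exists a, s = spec_cst _ a.
Proof.
pose I := [set d | exists a, s * spec_cst _ d = spec_cst _ a].
suff: I 1 by move=> [a e]; exists a; rewrite -e rmorph1 mulr1.
apply: prime_avoiding_unit => [|p].
  split.
  - by exists 0; rewrite !rmorph0 mulr0.
  - by move=> a b [c ec] [d ed]; exists (c + d); rewrite !rmorphD mulrDr ec ed.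
  - by move=> a b [c ec]; exists (a * c); rewrite !rmorphM mulrCA ec.
have [V [Vp _ [a [b h]]]] := sec_valP s (Logic.I : open_set (topO _) p).
exists b; last by have [] := h p Logic.I Vp.
exists a; apply: spec_sec_ext => q qT.
have [W [Wq _ [c [d k]]]] := sec_valP s qT.
have [b0 e1] := h zero_prime Logic.I (zero_prime_open Vp).
have [d0 e2] := k zero_prime Logic.I (zero_prime_open Wq).
have [qd e3] := k q qT Wq.
move: e2; rewrite e1 => /mkloc_zero_prime e.
rewrite [LHS]/= e3 [LHS]loc_mulE; apply: mkloc_congr.
by rewrite mulr1 -e mulr1.
Qed.

(** If a prime contained [a] and [b], clearing denominators in the relation near it would put into
    the prime a product of elements outside it. *)
Lemma spec_unimodular (a b : A) :
  (forall p : primeIdeal A, exists (U : opens (primeIdeal A)) (y z : spec_sec U),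
     open_set U p /\ y * spec_cst U a + z * spec_cst U b = 1) ->
  exists x y, x * a + y * b = 1.
Proof.
move=> H; pose I := [set d | exists x y, x * a + y * b = d].
suff : I 1 by [].
apply: prime_avoiding_unit => [|p].
  split.
  - by exists 0, 0; ring.
  - move=> _ _ [x [y <-]] [x' [y' <-]]; exists (x + x'), (y + y'); ring.
  - move=> c _ [x [y <-]]; exists (c * x), (c * y); ring.
apply: contrapT => Ip.
have pa : p a.
  by apply: contrapT => pa; apply: Ip; exists a => //; exists 1, 0; ring.
have pb : p b.
  by apply: contrapT => pb; apply: Ip; exists b => //; exists 0, 1; ring.
have [U [y [z [Up]]]] := H p.
move=> /(congr1 (fun s => sec_val s Up)) /=.
have [c [d [pd ->]]] := mklocP (sec_val y Up).
have [e [f [pf ->]]] := mklocP (sec_val z Up).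
rewrite [X in X + _]loc_mulE [X in _ + X]loc_mulE [LHS]loc_addE.
move=> /mkloc_eq [u pu]; rewrite !(mulr1, mul1r) mulrBr => /eqP.
rewrite subr_eq0 => /eqP eu.
suff : p (u * (d * f)) by apply: primeNM => //; exact: primeNM.
rewrite -eu; apply: primeMl; apply: primeD.
  by rewrite mulrAC; apply: primeMl.
by rewrite mulrAC; apply: primeMl.
Qed.

End SpecConstants.

(** * Identity morphisms, affine schemes and pullback of global sections *)

Section IdentityMorphism.
Variable X : lrSpace.

Lemma cont_id : continuous (fun x : X => x).
Proof. by move=> x. Qed.

(** The sheaf map is a restriction because [preO cont_id U] and [U] have the same points but are not
    convertible. *)
Definition id_mor : lrMor X X.
Proof.
pose k (U : opens X) : preO cont_id U `<=` U := fun x Ux => Ux.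
exists (fun x => x) cont_id (fun U => @res X _ _ (k U)).
- by move=> U V h h' s; rewrite !(res_comp _ _ (subset_trans (k V) h)).
- move=> x U s Ux [V [h [Vx [t e]]]]; exists V, h; split=> //; exists t.
  by rewrite -[RHS]e res_comp.
Defined.

Lemma id_mor_open_immersion : open_immersion id_mor.
Proof.
split=> [x y //|V oV|U _]; first by rewrite image_id.
have k : U `<=` preO cont_id U by [].
exists (res k) => s; last by rewrite /= res_comp; exact: res_id.
by rewrite res_comp res_id.
Qed.

End IdentityMorphism.

Definition affine_scheme (A : comPzRingType) : scheme.
Proof.
exists (Spec A) => x; exists A, (id_mor (Spec A)).
by split; [exact: id_mor_open_immersion|exists x].
Defined.

Section PullGlobal.
Variables (X Y : lrSpace) (f : lrMor X Y).

Lemma pull_global_zmod : zmod_morphism (pull_global f).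
Proof. by move=> s t; rewrite /pull_global /pull !rmorphB. Qed.

Lemma pull_global_monoid : monoid_morphism (pull_global f).
Proof. by split=> [|s t]; rewrite /pull_global /pull ?rmorph1 ?rmorphM. Qed.

HB.instance Definition _ := GRing.isZmodMorphism.Build
  (@sec Y (topO Y)) (@sec X (topO X)) (pull_global f) pull_global_zmod.
HB.instance Definition _ := GRing.isMonoidMorphism.Build
  (@sec Y (topO Y)) (@sec X (topO X)) (pull_global f) pull_global_monoid.

Lemma res_pull_global (V : opens Y) (hV : V `<=` topO Y)
    (h : preO (@mor_cont _ _ f) V `<=` topO X) (s : @sec Y (topO Y)) :
  res h (pull_global f s) = mor_sec f V (res hV s).
Proof.
have h' : preO (@mor_cont _ _ f) V `<=` preO (@mor_cont _ _ f) (topO Y) by [].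
by rewrite /pull_global /pull (res_comp _ _ h') -mor_res.
Qed.

End PullGlobal.

(** * Generators of a trivial line bundle *)

Section Generator.
Variable X : ringedSpace.

Definition generator (n : nat) (L : subsheaf X n 1)
    (v : 'cV[@sec X (topO X)]_n) :=
  forall (V : opens X) (h : V `<=` topO X),
    [/\ L V (map_mx (res h) v),
        forall s, L V s -> exists a, s = a *: map_mx (res h) v &
        forall a, a *: map_mx (res h) v = 0 -> a = 0].

(** The generator is the global section that the isomorphism sends to 1. *)
Lemma trivial_generator (n : nat) (L : subsheaf X n 1) :
  sheaf_iso L (free_sheaf X 1) -> exists v, generator L v.
Proof.
move=> [f [fbij flin fres]].
have hT : topO X `<=` topO X by [].
have [_ _ fsurj] := fbij (topO X) hT.
have [v Lv fv] := fsurj 1%:M Logic.I.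
exists v => V h; have LvV : L V (map_mx (res h) v) by exact: sub_res.
have fvV : f V h (map_mx (res h) v) = 1%:M.
  by rewrite (fres _ _ hT h h v Lv) fv map_mx1.
have [_ finj _] := fbij V h.
have L0 : L V 0 by exact: sub0.
have f0 : f V h 0 = 0.
  have := flin V h 1 0 0 L0 L0; rewrite !scale1r addr0 => /eqP.
  by rewrite -subr_eq0 opprD addNKr oppr_eq0 => /eqP.
have fav a : f V h (a *: map_mx (res h) v) = a%:M.
  by have := flin V h a _ 0 LvV L0; rewrite f0 !addr0 fvV scalemx1.
have Lav a : L V (a *: map_mx (res h) v).
  by have := sub_linear a LvV L0; rewrite addr0.
split=> // [s Ls|a av0].
  exists (f V h s ord0 ord0); apply: finj; rewrite ?inE // fav.
  by apply/matrixP => i j; rewrite !ord1 mxE eqxx mulr1n.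
have := fav a; rewrite av0 f0 => /matrixP /(_ ord0 ord0).
by rewrite !mxE eqxx mulr1n.
Qed.

(* If B is the matrix of the quotient map O^n -> O^r and C is a local right
   inverse of B, then the columns of 1 - C B are in the kernel O v of B, so
   that 1 = C B + v z; multiplying by v gives v = v (z v), whence z v = 1. *)
Lemma generator_unimodular (n : nat) (L : subsheaf X n 1) v (x : X) :
  locally_free_quotient L -> generator L v ->
  exists (W : opens X) (h : W `<=` topO X) (z : 'rV[sec W]_n),
    open_set W x /\ z *m map_mx (res h) v = 1%:M.
Proof.
move=> Lq vL; have [U [r [Ux [f [flin fres fker fsurj]]]]] := Lq x.
have UU : U `<=` U by [].
(* Surjectivity is only local, so each basis vector of O^r is lifted on its own neighbourhood [W j]
   of [x]. *)
have /choice[W Wc] : forall j : 'I_r, exists W : opens X,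
    [/\ open_set W x, W `<=` U & forall h : W `<=` U, exists c : 'cV[sec W]_n,
       f W h c = map_mx (res h) (delta_mx j ord0)].
  move=> j.
  have [W [hW [hW' [c [Wx ce]]]]] := fsurj U UU (delta_mx j ord0) x Ux.
  exists W; split=> // h; exists c.
  by rewrite (Prop_irrelevance h hW) ce (Prop_irrelevance hW hW').
have hW j : W j `<=` U by case: (Wc j).
have cE j : {c | f (W j) (hW j) c = map_mx (res (hW j)) (delta_mx j ord0)}.
  by apply: cid; case: (Wc j) => _ _; exact.
pose c j := sval (cE j).
(* There are finitely many [W j], so the interior of their intersection still contains [x]. *)
have [W0 [W0x W0U W0W]] : exists W0 : opens X,
    [/\ open_set W0 x, W0 `<=` U & forall j, W0 `<=` W j].
  have Wnbhs : nbhs x (fun y => forall j, open_set (W j) y).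
    apply: filter_forall => j; apply: open_nbhs_nbhs; split.
      exact: open_setP.
    by case: (Wc j).
  have oW : open (interior (\bigcap_j open_set (W j))) by exact: open_interior.
  exists (Opens (openI (open_setP U) oW)); split=> /=.
  - by split=> //; apply: filterS Wnbhs => y yW j _; exact: yW.
  - by move=> y [].
  - by move=> j y [_ /interior_subset]; apply.
have hT : W0 `<=` topO X by [].
exists W0, hT.
pose C := \matrix_(i < n, j < r) res (W0W j) (c j i ord0).
pose g := f W0 W0U.
have gC j : g (col j C) = delta_mx j ord0.
  have /(congr1 (map_mx (res (W0W j)))) := svalP (cE j).
  rewrite -(fres _ _ (hW j) W0U) -map_mx_comp => e.
  transitivity (map_mx (res W0U) (delta_mx j ord0 : 'cV[sec U]_r)).
    have -> : col j C = map_mx (res (W0W j)) (c j).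
      by apply/matrixP => i k; rewrite !mxE (ord1 k).
    by rewrite /g e; apply/matrixP => i k; rewrite !mxE /= res_comp.
  exact: map_delta_mx.
have g0 : g 0 = 0.
  have := flin W0 W0U 1 0 0; rewrite !scale1r addr0 -/g => /eqP.
  by rewrite -subr_eq0 opprD addNKr oppr_eq0 => /eqP.
have gD s t : g (s + t) = g s + g t.
  by have := flin W0 W0U 1 s t; rewrite !scale1r.
have gZ a s : g (a *: s) = a *: g s.
  by have := flin W0 W0U a s 0; rewrite -/g g0 !addr0.
have gsum m (a : 'I_m -> sec W0) (s : 'I_m -> 'cV[sec W0]_n) :
    g (\sum_i a i *: s i) = \sum_i a i *: g (s i).
  by rewrite (big_morph g gD g0); apply: eq_bigr => i _; exact: gZ.
have gCm t : g (C *m t) = t.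
  have -> : C *m t = \sum_j t j ord0 *: col j C.
    apply/matrixP => i k; rewrite !mxE summxE; apply: eq_bigr => j _.
    by rewrite !mxE (ord1 k) mulrC.
  rewrite gsum; apply/matrixP => i k; rewrite summxE (bigD1 i) //= big1.
    by rewrite gC !mxE (ord1 k) !eqxx mulr1 addr0.
  by move=> j ji; rewrite gC !mxE eq_sym (negPf ji) mulr0.
have [vLW0 vgen vfree] := vL W0 hT.
set w := map_mx (res hT) v in vLW0 vgen vfree *.
pose e i : 'cV[sec W0]_n := delta_mx i ord0.
have /choice[z zE] i : exists a, e i - C *m g (e i) = a *: w.
  apply: vgen; apply/(fker W0 W0U); rewrite -/g.
  by rewrite gD -[- _]scaleN1r gZ gCm scaleN1r subrr.
exists (\row_i z i); split=> //.
have wE : w = \sum_i w i ord0 *: e i.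
  apply/matrixP => i k; rewrite summxE (bigD1 i) //= big1.
    by rewrite !mxE (ord1 k) !eqxx mulr1 addr0.
  by move=> j ji; rewrite !mxE eq_sym (negPf ji) mulr0.
have gw : g w = 0 by apply/fker.
have : (1 - \sum_i z i * w i ord0) *: w = 0.
  rewrite scalerBl scale1r scaler_suml.
  have -> : \sum_i (z i * w i ord0) *: w = w.
    transitivity (\sum_i (w i ord0 *: e i - C *m g (w i ord0 *: e i))).
      apply: eq_bigr => i _; rewrite mulrC -scalerA -zE scalerBr gZ.
      by rewrite scalemxAr.
    rewrite sumrB -mulmx_sumr -wE -(big_morph g gD g0) -wE gw mulmx0.
    by rewrite subr0.
  by rewrite subrr.
move=> /vfree /eqP; rewrite subr_eq0 => /eqP e1.
apply/matrixP => i j; rewrite !mxE !ord1 eqxx mulr1n e1.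
by apply: eq_bigr => k _; rewrite mxE.
Qed.

End Generator.

(** * A criterion for Borel molds of degree 2 *)

Lemma ord2P (P : 'I_2 -> Prop) : P 0 -> P 1 -> forall i, P i.
Proof.
move=> P0 P1 [[|[|//]] hi].
  by rewrite (_ : Ordinal hi = 0) //; exact: val_inj.
by rewrite (_ : Ordinal hi = 1) //; exact: val_inj.
Qed.

Lemma matrix2P (R : Type) (s t : 'M[R]_2) : s 0 0 = t 0 0 -> s 0 1 = t 0 1 ->
  s 1 0 = t 1 0 -> s 1 1 = t 1 1 -> s = t.
Proof. by move=> *; apply/matrixP; do 2! [apply: ord2P]. Qed.

Section BorelCriterion.
Variable X : ringedSpace.

Definition restr (m n : nat) (V : opens X) (s : 'M[@sec X (topO X)]_(m, n)) :
  'M[sec V]_(m, n) := map_mx (@res X (topO X) V (@subsetT _ V)) s.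

Lemma map_mx_res_comp (m n : nat) (U V W : opens X) (hVU : V `<=` U)
    (hWV : W `<=` V) (hWU : W `<=` U) (s : 'M[sec U]_(m, n)) :
  map_mx (res hWV) (map_mx (res hVU) s) = map_mx (res hWU) s.
Proof. by apply/matrixP => i j; rewrite !mxE res_comp. Qed.

Lemma map_mx_res_restr (m n : nat) (V W : opens X) (h : W `<=` V)
    (s : 'M[@sec X (topO X)]_(m, n)) :
  map_mx (res h) (restr V s) = restr W s.
Proof. exact: map_mx_res_comp. Qed.

Definition triangular_over (U : opens X) (F : subsheaf X 2 2)
    (P Q : 'M[sec U]_2) :=
  [/\ P *m Q = 1%:M, Q *m P = 1%:M &
    forall (V : opens X) (h : V `<=` U) s,
      F V s <-> (map_mx (res h) Q *m s *m map_mx (res h) P) 1 0 = 0].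

Section Conjugate.
Variables (U : opens X) (F : subsheaf X 2 2) (P Q : 'M[sec U]_2).
Hypothesis tri : triangular_over F P Q.

Definition conj_over (V : opens X) (h : V `<=` U) (s : 'M[sec V]_2) :=
  map_mx (res h) Q *m s *m map_mx (res h) P.
Definition unconj_over (V : opens X) (h : V `<=` U) (s : 'M[sec V]_2) :=
  map_mx (res h) P *m s *m map_mx (res h) Q.

Lemma conj_overK (V : opens X) (h : V `<=` U) : cancel (conj_over h) (unconj_over h).
Proof.
case: tri => PQ _ _ s; rewrite /conj_over /unconj_over !mulmxA -map_mxM PQ map_mx1 mul1mx.
by rewrite -mulmxA -map_mxM PQ map_mx1 mulmx1.
Qed.

Lemma unconj_overK (V : opens X) (h : V `<=` U) : cancel (unconj_over h) (conj_over h).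
Proof.
case: tri => _ QP _ s; rewrite /conj_over /unconj_over !mulmxA -map_mxM QP map_mx1 mul1mx.
by rewrite -mulmxA -map_mxM QP map_mx1 mulmx1.
Qed.

Lemma conj_over_linear (V : opens X) (h : V `<=` U) (a : sec V) s t :
  conj_over h (a *: s + t) = a *: conj_over h s + conj_over h t.
Proof. by rewrite /conj_over mulmxDr mulmxDl -scalemxAr -scalemxAl. Qed.

Lemma conj_over_res (V W : opens X) (hV : V `<=` U) (hW : W `<=` U) (h : W `<=` V) s :
  conj_over hW (map_mx (res h) s) = map_mx (res h) (conj_over hV s).
Proof. by rewrite /conj_over !map_mxM !(map_mx_res_comp _ _ hW). Qed.

Lemma triangular_iso_on : iso_on U F (free_sheaf X 3).
Proof.
case: (tri) => _ _ FE.
exists (fun V h s => let t := conj_over h s in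
  \col_(k < 3) [:: t 0 0; t 0 1; t 1 1]`_k); split.
- move=> V h; split=> [//|s t|t _].
    rewrite !inE => /FE s10 /FE t10 /matrixP e.
    apply: (can_inj (conj_overK h)); apply: matrix2P.
    - by have := e 0 0; rewrite mxE [RHS]mxE.
    - by have := e 1 0; rewrite mxE [RHS]mxE.
    - by rewrite [LHS]s10 [RHS]t10.
    - by have := e (inord 2) 0; rewrite mxE [RHS]mxE inordK.
  pose T : 'M[sec V]_2 := \matrix_(i, j)
    if i == 0 then (if j == 0 then t 0 0 else t 1 0)
    else if j == 0 then 0 else t (inord 2) 0.
  exists (unconj_over h T); first by apply/FE; rewrite [_ *m _ *m _]unconj_overK mxE.
  rewrite unconj_overK; apply/matrixP => i j; rewrite !mxE /= (ord1 j).
  case: i => -[|[|[|//]]] hi /=; congr (t _ _); apply: val_inj => //=.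
  by rewrite inordK.
- move=> V h a s t _ _; rewrite conj_over_linear.
  by apply/matrixP => -[[|[|[|//]]] hi] j; rewrite !mxE.
- move=> V W hV hW h s _; rewrite (conj_over_res hV hW h).
  by apply/matrixP => -[[|[|[|//]]] hi] j; rewrite !mxE.
Qed.

(** The quotient map is the entry below the diagonal after conjugation. It is onto over [V] itself:
    a scalar is lifted to the conjugate of its multiple of e_10. *)
Lemma triangular_quotient : quotient_free_on U 1 F.
Proof.
case: (tri) => _ _ FE.
exists (fun V h s => const_mx (conj_over h s 1 0)); split.
- by move=> V h a s t; rewrite conj_over_linear; apply/matrixP => i j; rewrite !mxE.
- move=> V W hV hW h s; rewrite (conj_over_res hV hW h).
  by apply/matrixP => i j; rewrite !mxE.
- move=> V h s; rewrite FE; split=> [/matrixP /(_ 0 0) e|e].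
    by rewrite mxE [RHS]mxE in e; exact: e.
  by apply/matrixP => i j; rewrite mxE [RHS]mxE; exact: e.
- move=> V h t x Vx; exists V, h, (fun _ x => x).
  exists (unconj_over h (t 0 0 *: delta_mx 1 0)); split=> //; rewrite unconj_overK.
  by apply/matrixP => i j; rewrite !mxE !ord1 /= mulr1 res_id.
Qed.

Lemma triangular_sheaf_conj (V : opens X) (h : V `<=` U) :
  triangular_sheaf X 2 V = [set conj_over h s | s in F V].
Proof.
case: (tri) => _ _ FE; apply/seteqP; split=> [t tt|_ [s /FE s10 <-] i j].
  exists (unconj_over h t); last exact: unconj_overK.
  by apply/FE; rewrite [_ *m _ *m _]unconj_overK; exact: tt.
by move: i j; apply: ord2P => [j|]; [|apply: ord2P] => // _; exact: s10.
Qed.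

End Conjugate.

(** One local conjugation gives everything: the three upper entries trivialize [F], the fourth
    trivializes the quotient, and the conjugation itself is the local equivalence. *)
Lemma borel_mold2 (F : subsheaf X 2 2) : subalgebra_sheaf F ->
  (forall x : X, exists (U : opens X) (P Q : 'M[sec U]_2),
      open_set U x /\ triangular_over F P Q) ->
  borel_mold F.
Proof.
move=> Falg Ftri; split; last first.
  move=> x; have [U [P [Q [Ux tri]]]] := Ftri x; exists U, P, Q.
  by case: (tri) => PQ QP _; split=> // V h; exact: triangular_sheaf_conj.
split=> // x; have [U [P [Q [Ux tri]]]] := Ftri x.
  by exists U, 3; split=> //; exact: triangular_iso_on tri.
by exists U, 1; split=> //; exact: triangular_quotient tri.
Qed.

(* The endomorphisms preserving the image of the idempotent E. *)
Definition stabilizer_sheaf (n : nat) (E : 'M[@sec X (topO X)]_n) :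
  subsheaf X n n.
Proof.
exists (fun U => [set s | (1%:M - restr U E) *m s *m restr U E = 0]).
- by move=> U /=; rewrite mulmx0 mul0mx.
- move=> U a s t /= es et; rewrite mulmxDr mulmxDl -scalemxAr -scalemxAl.
  by rewrite es et scaler0 addr0.
- move=> U V h s /= /(congr1 (map_mx (res h))).
  by rewrite map_mx0 !map_mxM map_mxB map_mx1 !map_mx_res_restr.
- move=> U s H /=; apply/matrixP => i j; rewrite [RHS]mxE; apply: sheaf_sep.
  move=> x /H [V [h [Vx /= /matrixP /(_ i j) e]]]; exists V, h; split=> //.
  move: e; rewrite [RHS]mxE rmorph0 => <-.
  rewrite -!(map_mx_res_restr h) -(map_mx1 (res h)) -map_mxB -!map_mxM.
  by rewrite [RHS]mxE.
Defined.

(** For idempotent [E] membership means s E = E s E, and then s t E = s E t E = E s E t E. *)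
Lemma stabilizer_subalgebra (n : nat) (E : 'M[@sec X (topO X)]_n) :
  E *m E = E -> subalgebra_sheaf (stabilizer_sheaf E).
Proof.
move=> EE U; have {}EE : restr U E *m restr U E = restr U E.
  by rewrite -map_mxM EE.
have stab s : stabilizer_sheaf E U s -> s *m restr U E = restr U E *m s *m restr U E.
  move=> /eqP; rewrite -mulmxA mulmxBl mul1mx subr_eq0 => /eqP ->.
  by rewrite mulmxA.
split=> /= [|s t es et]; first by rewrite mulmx1 mulmxBl mul1mx EE subrr.
by rewrite -!mulmxA (stab t et) !mulmxA es !mul0mx.
Qed.

(** The generated algebra is squeezed. It lies in the stabilizer of the image of [E], which is
    triangular in the local basis [P]; it contains 1, [E] and [N], which there become 1, e_00 and a
    unit multiple of e_01 and so span all triangular matrices. *)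
Lemma generated_algebra_borel (E N : 'M[@sec X (topO X)]_2)
    (S : set 'M[@sec X (topO X)]_2) :
  E *m E = E -> S `<=` stabilizer_sheaf E (topO X) ->
  generated_algebra S (topO X) E -> generated_algebra S (topO X) N ->
  (forall x : X, exists (U : opens X) (P Q : 'M[sec U]_2) (m k : sec U),
    [/\ open_set U x, P *m Q = 1%:M /\ Q *m P = 1%:M, m * k = 1,
      Q *m restr U E *m P = delta_mx 0 0 &
      Q *m restr U N *m P = m *: delta_mx 0 1]) ->
  borel_mold (generated_algebra S).
Proof.
move=> EE Sstab SE SN H; set F := generated_algebra S.
have Falg : subalgebra_sheaf F.
  move=> U; split=> [G GA _|s t Fs Ft G GA SG]; first by case: (GA U).
  by have [_] := GA U; apply; [exact: Fs|exact: Ft].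
apply: borel_mold2 => // x.
have [U [P [Q [m [k [Ux [PQ QP] mk QEP QNP]]]]]] := H x.
exists U, P, Q; split=> //; split=> // V h s.
set PV := map_mx _ P; set QV := map_mx _ Q.
have {}PQ : PV *m QV = 1%:M by rewrite -map_mxM PQ map_mx1.
have {}QP : QV *m PV = 1%:M by rewrite -map_mxM QP map_mx1.
have {}QEP : QV *m restr V E *m PV = delta_mx 0 0.
  by rewrite -(map_mx_res_restr h) -!map_mxM QEP map_delta_mx.
have {}QNP : QV *m restr V N *m PV = res h m *: delta_mx 0 1.
  by rewrite -(map_mx_res_restr h) -!map_mxM QNP map_mxZ map_delta_mx.
split=> [Fs|e].
  have := Fs _ (stabilizer_subalgebra EE) Sstab => /= es.
  have : QV *m ((1%:M - restr V E) *m s *m restr V E) *m PV = 0.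
    by rewrite es mulmx0 mul0mx.
  have -> : QV *m ((1%:M - restr V E) *m s *m restr V E) *m PV =
      (1%:M - delta_mx 0 0) *m (QV *m s *m PV) *m delta_mx 0 0.
    have conjM (Y Z : 'M_2) :
        QV *m (Y *m Z) *m PV = (QV *m Y *m PV) *m (QV *m Z *m PV).
      by rewrite -!mulmxA (mulmxA PV QV) PQ mul1mx.
    by rewrite !conjM mulmxBr mulmx1 mulmxBl QP QEP.
  move: (QV *m s *m PV) => T /matrixP /(_ 1 0).
  rewrite !(mxE, big_ord_recl, big_ord0) /= !(mulr0, mul0r, addr0, add0r).
  rewrite (_ : lift ord0 ord0 = 1); last exact: val_inj.
  by rewrite mulr1 oppr0 mul0r add0r addr0 mul1r.
set t := QV *m s *m PV in e.
(* After conjugation this is t = t_00 e_00 + t_01 e_01 + t_11 (1 - e_00), with [k] cancelling the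
   unit [m]. The final [+ 0] fits closure under a s + t. *)
have -> : s = t 0 0 *: restr V E + (t 0 1 * res h k *: restr V N +
    (- t 1 1 *: restr V E + (t 1 1 *: 1%:M + 0))).
  have K (Y : 'M_2) : PV *m (QV *m Y *m PV) *m QV = Y.
    by rewrite -!mulmxA PQ mulmx1 mulmxA PQ mul1mx.
  rewrite -[LHS]K -[RHS]K -/t; congr (_ *m _ *m _).
  rewrite addr0 !mulmxDr !mulmxDl -!scalemxAr -!scalemxAl mulmx1 QP QEP QNP.
  have mkV : res h k * res h m = 1 by rewrite -rmorphM mulrC mk rmorph1.
  move: t e => t e; apply: matrix2P; rewrite !mxE /= ?e; ring: mkV.
have FE : F V (restr V E) by exact: sub_res.
have FN : F V (restr V N) by exact: sub_res.
do 4! [apply: sub_linear => //]; last exact: sub0.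
by case: (Falg V).
Qed.

End BorelCriterion.

(** * The infinite dihedral group and its matrices *)

Definition dihedral := (bool * int)%type.

HB.instance Definition _ := Choice.on dihedral.

(** Semidirect product of Z by Z/2 acting by sign. It is the target of the map out of the free
    group, so the invertible matrices themselves need no group structure. *)
Definition dihedral_mul (g h : dihedral) : dihedral :=
  (g.1 (+) h.1, (-1) ^+ g.1 * h.2 + g.2).

Definition dihedral_inv (g : dihedral) : dihedral :=
  (g.1, - ((-1) ^+ g.1 * g.2)).

Lemma dihedral_mulA : associative dihedral_mul.
Proof.
move=> g h k; rewrite /dihedral_mul /= addbA; congr pair.
by rewrite signr_addb mulrDr mulrA addrA.
Qed.

Lemma dihedral_mul1 : left_id (false, 0) dihedral_mul.
Proof. by move=> [e b]; rewrite /dihedral_mul /= mul1r addr0. Qed.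

Lemma dihedral_1mul : right_id (false, 0) dihedral_mul.
Proof. by move=> [e b]; rewrite /dihedral_mul /= addbF mulr0 add0r. Qed.

Lemma dihedral_mulV : left_inverse (false, 0) dihedral_inv dihedral_mul.
Proof. by move=> [e b]; rewrite /dihedral_mul /= addbb subrr. Qed.

Lemma dihedral_mulN : right_inverse (false, 0) dihedral_inv dihedral_mul.
Proof.
move=> [e b]; rewrite /dihedral_mul /= addbb mulrN mulrA -expr2 sqrr_sign.
by rewrite mul1r addNr.
Qed.

HB.instance Definition _ := isGroup.Build dihedral dihedral_mulA
  dihedral_mul1 dihedral_1mul dihedral_mulV dihedral_mulN.

Section DihedralMatrices.
Variables (R : comPzRingType) (n : nat) (E N : 'M[R]_n).
Hypotheses (EE : E *m E = E) (EN : E *m N = N) (NE : N *m E = 0).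

(** In a basis where [E] is e_00 and [N] is e_01, this has rows (±1, b) and (0, 1). The generators
    (true, 0) and (false, 1) go to 1 - 2 E and 1 + N. *)
Definition dihedral_mx (g : dihedral) : 'M[R]_n :=
  (-1) ^+ g.1 *: E + (1%:M - E) + g.2%:~R *: N.

Lemma dihedral_mx1 : dihedral_mx 1%g = 1%:M.
Proof. by rewrite /dihedral_mx scale1r scale0r addr0 addrC subrK. Qed.

Lemma dihedral_mxM g h :
  dihedral_mx (g * h)%g = dihedral_mx g *m dihedral_mx h.
Proof.
have NN : N *m N = 0 by rewrite -{2}EN mulmxA NE mul0mx.
rewrite /dihedral_mx !(mulmxDl, mulmxDr, mul1mx, mulmx1).
rewrite !mulmxN !mulNmx -!scalemxAl -!scalemxAr !(EE, EN, NE, NN) /= !scaler0.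
rewrite signr_addb intrD intrM rmorph_sign.
apply/matrixP => i j; rewrite !mxE; ring.

Qed.

Lemma dihedral_mx_stab g : (1%:M - E) *m dihedral_mx g *m E = 0.
Proof.
rewrite -mulmxA; have -> : dihedral_mx g *m E = (-1) ^+ g.1 *: E.
  rewrite /dihedral_mx !mulmxDl mulNmx mul1mx -!scalemxAl EE NE subrr scaler0.
  by rewrite !addr0.
by rewrite -scalemxAr mulmxBl mul1mx EE subrr scaler0.
Qed.

End DihedralMatrices.

(** * Dihedral representations over an affine scheme *)

Lemma restr_cst (A : comPzRingType) (m n : nat) (U : opens (Spec A))
    (s : 'M[A]_(m, n)) :
  restr (X := Spec A) U (map_mx (@spec_cst A (topO _)) s) =
  map_mx (@spec_cst A U) s.
Proof.
apply/matrixP => i j; rewrite !mxE.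
exact: (@spec_res_cst A (topO _) U (@subsetT _ U) (s i j)).
Qed.

Section DihedralRepresentation.
Variables (A : comPzRingType) (E N : 'M[A]_2) (half : A).
Hypotheses (EE : E *m E = E) (EN : E *m N = N) (NE : N *m E = 0).
Hypothesis half2 : half + half = 1.
Variables (G : groupType) (phi : G -> dihedral) (a b : G).
Hypothesis phiM : {morph phi : u v / (u * v)%g}.
Hypotheses (phia : phi a = (true, 0)) (phib : phi b = (false, 1)).

Let cst := @spec_cst A (topO (primeIdeal A)).

Definition dihedral_rep_mx (g : G) :
    'M[@sec (affine_scheme A) (topO (affine_scheme A))]_2 :=
  map_mx cst (dihedral_mx E N (phi g)).

Lemma dihedral_rep_mx1 : dihedral_rep_mx 1%g = 1%:M.
Proof.
have phi1 : phi 1%g = 1%g by apply: (mulgI (phi 1%g)); rewrite -phiM !mulg1.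
by rewrite /dihedral_rep_mx phi1 dihedral_mx1 map_mx1.
Qed.

Lemma dihedral_rep_mxM g h :
  dihedral_rep_mx (g * h)%g = dihedral_rep_mx g *m dihedral_rep_mx h.
Proof. by rewrite /dihedral_rep_mx phiM dihedral_mxM // map_mxM. Qed.

Lemma dihedral_rep_mx_inv g : exists2 Q,
  dihedral_rep_mx g *m Q = 1%:M & Q *m dihedral_rep_mx g = 1%:M.
Proof.
exists (dihedral_rep_mx g^-1%g).
  by rewrite -dihedral_rep_mxM mulgV dihedral_rep_mx1.
by rewrite -dihedral_rep_mxM mulVg dihedral_rep_mx1.
Qed.

Definition dihedral_rep : representation G 2 (affine_scheme A) :=
  Representation dihedral_rep_mx1 dihedral_rep_mxM dihedral_rep_mx_inv.

(** The local bases are given without denominators: [Q] inverts [P] up to the scalar [d], and both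
    [d] and [m] become units on the basic open set of [d * m], a neighbourhood of [p]. *)
Lemma dihedral_rep_borel :
  (forall p : primeIdeal A, exists (P Q : 'M[A]_2) (d m : A),
    [/\ ~ p d /\ ~ p m, P *m Q = d%:M /\ Q *m P = d%:M,
      Q *m E *m P = d *: delta_mx 0 0 & Q *m N *m P = m *: delta_mx 0 1]) ->
  with_borel_mold dihedral_rep.
Proof.
move=> H; have rE g : dihedral_rep g = map_mx cst (dihedral_mx E N (phi g)) by [].
have genP g : generated_algebra (range dihedral_rep) (topO _) (dihedral_rep g).
  by move=> F _; apply; exists g.
have gen1 : generated_algebra (range dihedral_rep) (topO (affine_scheme A)) 1%:M.
  by move=> F /(_ (topO (affine_scheme A)))[F1 _] _; exact: F1.
have lin := @sub_linear _ _ _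
  (generated_algebra (range dihedral_rep)) (topO (affine_scheme A)).
have gen0 := @sub0 _ _ _
  (generated_algebra (range dihedral_rep)) (topO (affine_scheme A)).
apply: (@generated_algebra_borel (Spec A) (map_mx cst E) (map_mx cst N)).
- by rewrite -map_mxM EE.
- move=> _ [g _ <-]; rewrite rE /=.
  rewrite (restr_cst (A := A)).
  by rewrite -(map_mx1 cst) -map_mxB -!map_mxM dihedral_mx_stab // map_mx0.
(* Since 2 is invertible, E = (1 - (1 - 2 E)) / 2 lies in the generated algebra. *)
- have -> : map_mx cst E =
      cst half *: (-1 *: dihedral_rep a + 1%:M) + 0.
    rewrite rE phia addr0 scaleN1r -(map_mx1 cst) addrC -map_mxB -map_mxZ.
    congr map_mx; apply/matrixP => i j; rewrite !mxE.
    by rewrite /= expr1 -[LHS]mul1r -[X in X * _ = _]half2; ring.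
  apply: (lin _ _ _ (lin _ _ _ (genP a) gen1) gen0).
- have -> : map_mx cst N = -1 *: 1%:M + dihedral_rep b.
    rewrite rE phib scaleN1r -(map_mx1 cst) addrC -map_mxB.
    by congr map_mx; apply/matrixP => i j; rewrite !mxE /= expr0; ring.
  apply: (lin _ _ _ gen1 (genP b)).
- move=> p; have [P [Q [d [m [[pd pm] [PQ QP] QEP QNP]]]]] := H p.
  pose U := basic_open (d * m).
  pose f := @spec_cst A U.
  have [k mdk] : exists k : spec_sec U, f m * f d * k = 1.
    rewrite -rmorphM mulrC; exact: spec_cst_unit.
  (* As [k] inverts m d, the factor m k is 1/d; the coefficient of e_01 becomes m/d, with inverse
     d/m written d d k. *)
  exists U, (map_mx f P), (f m * k *: map_mx f Q), (f m * f m * k), (f d * f d * k).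
  split.
  - exact: primeNM.
  - rewrite -scalemxAl -scalemxAr -!map_mxM PQ QP map_scalar_mx.
    by rewrite scale_scalar_mx mulrAC mdk.
  - transitivity ((f m * f d * k) * (f m * f d * k));
    first by ring.
    by rewrite mdk mulr1.
  - rewrite (restr_cst (A := A)) -!scalemxAl -!map_mxM QEP map_mxZ.
    by rewrite map_delta_mx scalerA mulrAC mdk scale1r.
  - rewrite (restr_cst (A := A)) -!scalemxAl -!map_mxM QNP map_mxZ.
    by rewrite map_delta_mx scalerA mulrAC.
Qed.

End DihedralRepresentation.

(** * The nodal cubic and its line bundle of order 2 *)

Section NodalCurve.

Definition nodal : {pred {poly rat}} := fun p => p.[0] == p.[1].

Lemma nodal_subring : subring_closed nodal.
Proof.
split=> [|p q /eqP p01 /eqP q01|p q /eqP p01 /eqP q01]; apply/eqP.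
- by rewrite !hornerC.
- by rewrite !hornerD !hornerN p01 q01.
- by rewrite !hornerM p01 q01.
Qed.

HB.instance Definition _ :=
  GRing.isSubringClosed.Build {poly rat} nodal nodal_subring.

Record nodal_ring := Nodal {nodal_val : {poly rat}; nodalP : nodal_val \in nodal}.

HB.instance Definition _ := [isSub for nodal_val].
HB.instance Definition _ := [Choice of nodal_ring by <:].
HB.instance Definition _ := [SubChoice_isSubComNzRing of nodal_ring by <:].

Lemma nodal_dom (a b : nodal_ring) : a * b = 0 -> a = 0 \/ b = 0.
Proof.
move=> /(congr1 val); rewrite rmorphM rmorph0 => /eqP.
by rewrite mulf_eq0 => /orP[]/eqP e; [left|right]; apply: val_inj.
Qed.

Lemma nodal_nz1 : (1 : nodal_ring) <> 0.
Proof. by apply/eqP; exact: oner_neq0. Qed.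

Definition nodal_half : nodal_ring.
Proof. by exists (2^-1)%:P; apply/eqP; rewrite !hornerC. Defined.

Lemma nodal_half2 : nodal_half + nodal_half = 1.
Proof. by apply: val_inj; rewrite rmorphD /= -rmorphD /= -[RHS]polyC1. Qed.

(* Sections of the line bundle on the nodal curve glued with sign -1. *)
Record odd_poly := OddPoly {
  odd_val :> {poly rat};
  oddP : odd_val.[1] = - odd_val.[0]
}.

Definition odd_mul (p q : odd_poly) : nodal_ring.
Proof. by exists ((p : {poly rat}) * q); apply/eqP; rewrite !hornerM !oddP mulrNN. Defined.

Definition odd_opp (p : odd_poly) : odd_poly.
Proof. by exists (- (p : {poly rat})); rewrite !hornerN oddP. Defined.

Definition vec2 (T : Type) (x y : T) (i : 'I_2) := if i == 0 then x else y.

Definition odd_mx (x y z t : odd_poly) : 'M[nodal_ring]_2 :=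
  \matrix_(i, j) odd_mul (vec2 x y i) (vec2 z t j).

Lemma sum2 (V : nmodType) (F : 'I_2 -> V) : \sum_i F i = F 0 + F 1.
Proof. by rewrite !big_ord_recl big_ord0 addr0; congr (_ + F _); exact: val_inj. Qed.

Section MatrixUnits.
Variables c s c' s' : odd_poly.
Hypothesis cs1 : (c : {poly rat}) * c' = 1 - (s : {poly rat}) * s'.

Let E := odd_mx c s c' s'.
Let N := odd_mx c s (odd_opp s) c.

Ltac nodal_ring := apply: matrix2P; rewrite !(mxE, sum2) /=;
  apply: val_inj;
  rewrite !(rmorph1, rmorph0, rmorphM, rmorphD, rmorphMn, rmorphN) /=;
  rewrite ?mulr1n ?mulr0n;
  ring: cs1.

Lemma nodal_EE : E *m E = E.
Proof. nodal_ring. Qed.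

Lemma nodal_EN : E *m N = N.
Proof. nodal_ring. Qed.

Lemma nodal_NE : N *m E = 0.
Proof. nodal_ring. Qed.

Definition mx2 (R : Type) (x y z t : R) : 'M[R]_2 :=
  \matrix_(i, j) vec2 (vec2 x y j) (vec2 z t j) i.

(** The columns (c, s) and (-s', c') span the image and the kernel of [E] and have determinant 1,
    but odd entries. Scaling them by c' and c, or by s' and s, brings the entries into the ring;
    then [d] is the determinant c c' or s s', [Q] is the adjugate of [P], and [m] is c^2 or s^2. *)
Lemma nodal_local (p : primeIdeal nodal_ring) :
  exists (P Q : 'M[nodal_ring]_2) (d m : nodal_ring),
    [/\ ~ p d /\ ~ p m, P *m Q = d%:M /\ Q *m P = d%:M,
      Q *m E *m P = d *: delta_mx 0 0 & Q *m N *m P = m *: delta_mx 0 1].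
Proof.
(* An odd polynomial need not lie in the ring, so divisibility is replaced by x^2 y^2 = (x y)^2. *)
have np x y : ~ p (odd_mul x y) -> ~ p (odd_mul x x).
  move=> pxy pxx; have : p (odd_mul y y * odd_mul x x) by exact: primeMl.
  have -> : odd_mul y y * odd_mul x x = odd_mul x y * odd_mul x y.
    by apply: val_inj; rewrite !rmorphM /=; ring.
  by case/primeM.
case: (pselect (p (odd_mul c c'))) => pc; last first.
  exists (mx2 (odd_mul c c') (odd_mul c (odd_opp s')) (odd_mul s c') (odd_mul c c')).
  exists (mx2 (odd_mul c c') (odd_mul c s') (odd_mul s (odd_opp c')) (odd_mul c c')).
  exists (odd_mul c c'), (odd_mul c c).
  by split; [split=> //; exact: np pc|split; nodal_ring|nodal_ring|nodal_ring].
(* Since c c' + s s' = 1, at least one of the two products avoids [p]. *)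
have ps : ~ p (odd_mul s s').
  move=> ps; apply: (@primeN1 _ p).
  have <- : odd_mul c c' + odd_mul s s' = 1; last exact: primeD.
  by apply: val_inj; rewrite !(rmorphD, rmorph1) /=; ring: cs1.
exists (mx2 (odd_mul c s') (odd_mul s (odd_opp s')) (odd_mul s s') (odd_mul s c')).
exists (mx2 (odd_mul s c') (odd_mul s s') (odd_mul s (odd_opp s')) (odd_mul c s')).
exists (odd_mul s s'), (odd_mul s s).
by split; [split=> //; exact: np ps|split; nodal_ring|nodal_ring|nodal_ring].
Qed.

Lemma nodal_no_generator (w : 'cV[nodal_ring]_2) (a x y : nodal_ring) :
  (1%:M + N) *m w = a *: w -> x * w 0 0 + y * w 1 0 = 1 -> False.
Proof.
move=> Nw /(congr1 val); rewrite !(rmorphD, rmorphM, rmorph1) /= => xy1.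
move: (congr1 (fun v : 'cV_2 => val (v 0 0)) Nw).
move: (congr1 (fun v : 'cV_2 => val (v 1 0)) Nw).
rewrite !mxE !sum2 !mxE !(rmorphD, rmorphM, rmorphMn, rmorph1) /=.
move: (nodalP (w 0 0)) (nodalP (w 1 0)) => /eqP w0P /eqP w1P.
move: xy1 w0P w1P; rewrite -![nodal_val (w _ _)]/(val _).
move: (val (w 0 0)) (val (w 1 0)) (val a) (val x) (val y).
move=> {Nw a x y w} w0 w1 a x y xy1 w0P w1P.
(* N w = g (c, s)^T, so the eigenvector equation reads c g = (a - 1) w0 and s g = (a - 1) w1. *)
rewrite /= => e1 e0; pose g := odd_val c * w1 - odd_val s * w0.
have ce : odd_val c * g = (a - 1) * w0.
  by rewrite mulrBl -e0 /g; ring.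
have se : odd_val s * g = (a - 1) * w1.
  by rewrite mulrBl -e1 /g; ring.
have g_split : g = odd_val c' * (odd_val c * g) + odd_val s' * (odd_val s * g).
  by ring: cs1.
(* N is nilpotent: substituting gives (a - 1) g = c s g - s c g = 0, and a = 1 also forces g = 0. *)
have g0 : g = 0.
  have : (a - 1) * g = 0.
    transitivity (odd_val c * ((a - 1) * w1) - odd_val s * ((a - 1) * w0));
      first by rewrite /g; ring.
    by rewrite -se -ce; ring.
  move/eqP; rewrite mulf_eq0 => /orP[/eqP a1|/eqP//].
  by rewrite g_split ce se a1 !mul0r !mulr0 addr0.
have sw : odd_val s * w0 = odd_val c * w1 by apply/esym/subr0_eq.
(* From N w = 0, [w] is [h] times (c, s). The relation x w0 + y w1 = 1 then makes [h] a unit of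
   Q[t]. *)
pose h := odd_val c' * w0 + odd_val s' * w1.
have w0E : w0 = odd_val c * h.
  transitivity ((odd_val c * odd_val c' + odd_val s * odd_val s') * w0);
    first by ring: cs1.
  transitivity (odd_val c * odd_val c' * w0 + odd_val s' * (odd_val s * w0));
    first by ring.
  by rewrite sw /h; ring.
have w1E : w1 = odd_val s * h.
  transitivity ((odd_val c * odd_val c' + odd_val s * odd_val s') * w1);
    first by ring: cs1.
  transitivity (odd_val s * odd_val s' * w1 + odd_val c' * (odd_val c * w1));
    first by ring.
  by rewrite -sw /h; ring.
have h_unit : (x * odd_val c + y * odd_val s) * h = 1 by rewrite -xy1 w0E w1E; ring.
have hodd : h.[1] = - h.[0].
  by rewrite /h !hornerD !hornerM !oddP -w0P -w1P; ring.
(* Units of Q[t] are nonzero constants, and an odd constant satisfies 2 k = 0. *)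
have /size_poly1P[k k0 hk] : size h == 1%N.
  have : h \is a GRing.unit.
    by apply/unitrPr; exists (x * odd_val c + y * odd_val s); rewrite mulrC.
  by rewrite poly_unitE => /andP[].
move: hodd; rewrite hk !hornerC => /eqP; rewrite -addr_eq0 -mulr2n Num.Theory.mulrn_eq0 /=.
by rewrite (negPf k0).
Qed.

End MatrixUnits.
Definition odd_c : odd_poly.
Proof. by exists (1 - 'X *+ 2); rewrite !hornerE; ring. Defined.

(** This polynomial vanishes at 0 and 1, hence is odd, and does not vanish at 1/2, the only zero of
    [odd_c]. *)
Definition odd_s : odd_poly.
Proof. by exists ('X - 'X ^+ 2); rewrite !hornerE; ring. Defined.

(* With c^2 = 1 - 4 s, squaring c^2 + 4 s = 1 gives
   c c (c^2 + 8 s) + 16 s^2 = 1. *)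
Definition odd_c' : odd_poly.
Proof.
exists ((1 - 'X *+ 2) * ((1 - 'X *+ 2) ^+ 2 + ('X - 'X ^+ 2) *+ 8)).
by rewrite !(hornerM, horner_exp, hornerD, hornerN, hornerMn, hornerX, hornerC); ring.
Defined.

Definition odd_s' : odd_poly.
Proof.
exists (('X - 'X ^+ 2) *+ 16).
by rewrite !(hornerMn, hornerD, hornerN, horner_exp, hornerX); ring.
Defined.

Lemma odd_cs1 :
  odd_val odd_c * odd_val odd_c' = 1 - odd_val odd_s * odd_val odd_s'.
Proof.
rewrite -[odd_val odd_c]/(1 - 'X *+ 2) -[odd_val odd_s]/('X - 'X ^+ 2).
rewrite -[odd_val odd_s']/(('X - 'X ^+ 2) *+ 16).
rewrite -[odd_val odd_c']/((1 - 'X *+ 2) *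
  ((1 - 'X *+ 2) ^+ 2 + ('X - 'X ^+ 2) *+ 8)).

ring.
Qed.

End NodalCurve.

(** * Pulling a generator back to the nodal cubic *)

Theorem proposition4p5 (F2 : groupType) (alpha beta : F2)
    (hF2 : free_group2 alpha beta)
    (X : scheme) (rho : representation F2 2 X)
    (hX : represents_borel_reps rho)
    (L : subsheaf X 2 1) (hL : universal_sub_line_bundle rho L) :
  ~ sheaf_iso L (free_sheaf X 1).
Proof.
case: hL => Linv _ Lq /trivial_generator [v vL].
have [phi [[phiM phia phib] _]] := hF2 dihedral (true, 0) (false, 1).
have EE := nodal_EE odd_cs1; have EN := nodal_EN odd_cs1.
have NE := nodal_NE odd_cs1.
pose sigma := dihedral_rep EE EN NE phiM.
have sigmaB : with_borel_mold sigma.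
  exact: (dihedral_rep_borel EE EN NE nodal_half2 phiM phia phib (nodal_local odd_cs1)).
have [_ /(_ _ _ sigmaB) [f [fsigma _]]] := hX.
pose w := map_mx (pull_global f) v.
have hT : topO X `<=` topO X by [].
have rid (s : 'M[@sec X (topO X)]_2) : map_mx (@res X (topO X) (topO X) (@subsetT _ _)) s = s.
  by apply/matrixP => i j; rewrite mxE res_id.
have [Lv vgen _] := vL (topO X) hT.
have vE : map_mx (res hT) v = v by apply/matrixP => i j; rewrite mxE res_id.
rewrite vE in Lv vgen.
(* Invariance makes [v] an eigenvector of [rho beta], so its pullback [w] is an eigenvector of
   [sigma beta], which is 1 + N. *)
have [a] := vgen _ (Linv beta (topO X) v Lv).
rewrite rid => /(congr1 (map_mx (pull_global f))).
rewrite map_mxM map_mxZ fsigma -/w => sw.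
(* Global sections on the nodal cubic come from its ring, so [w] and the eigenvalue descend to
   polynomials. *)
have gl := spec_global nodal_dom nodal_nz1.
have [w0 w0E] := gl (w 0 0); have [w1 w1E] := gl (w 1 0).
have [a' aE] := gl (pull_global f a).
pose cst := @spec_cst nodal_ring (topO _).
pose wA : 'cV[nodal_ring]_2 := \col_i vec2 w0 w1 i.
have wE : w = map_mx cst wA.
  apply/matrixP => i j; rewrite (ord1 j) !mxE; move: i.
  by apply: ord2P; [move: w0E|move: w1E]; rewrite mxE.
have Nw : (1%:M + odd_mx odd_c odd_s (odd_opp odd_s) odd_c) *m wA = a' *: wA.
  suff e : map_mx cst ((1%:M + odd_mx odd_c odd_s (odd_opp odd_s) odd_c) *m wA) =
      map_mx cst (a' *: wA).
    apply/matrixP => i j; apply: (spec_cst_inj nodal_dom nodal_nz1).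
    by move/matrixP: e => /(_ i j); rewrite !mxE.
  transitivity (pull_global f a *: w); last by rewrite aE wE map_mxZ.
  rewrite -sw wE map_mxM; congr (_ *m _); congr map_mx.
  by rewrite phib /dihedral_mx /= expr0 !scale1r [X in _ = X + _]addrC subrK.
suff [x [y xy1]] : exists x y, x * w0 + y * w1 = 1.
  by apply: (nodal_no_generator odd_cs1 Nw (x := x) (y := y)); rewrite !mxE.
(* Near [f p] the vector [v] has a left inverse [z]; its pullback is a left inverse of [w] near
   [p]. *)
apply: spec_unimodular => p.
have [W [h [z [Wp zv]]]] := generator_unimodular (f p) Lq vL.
pose V := preO (@mor_cont _ _ f) W.
exists V, (mor_sec f W (z 0 0)), (mor_sec f W (z 0 1)); split=> //.
have hV : V `<=` topO (primeIdeal nodal_ring) by [].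
have cstE i b : w i 0 = cst b -> spec_cst V b = mor_sec f W (res h (v i 0)).
  rewrite mxE => e; rewrite -(res_pull_global (V := W) h hV) e.
  exact/esym/spec_res_cst.
move: zv => /matrixP /(_ 0 0); rewrite mxE sum2 !mxE => /(congr1 (mor_sec f W)).
rewrite rmorphD !rmorphM => zv1.
rewrite (cstE _ _ w0E) (cstE _ _ w1E) [LHS]zv1; exact: rmorph1.
Qed.
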